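(* Let $\mathbb X$ be a Euclidean space, let $f\colon\mathbb X\to\mathbb R$ be continuously differentiable, let $\phi\colon\mathbb X\to\mathbb R\cup\{\infty\}$ be lower semicontinuous with $\operatorname{dom}\phi\neq\emptyset$, and set $\psi:=f+\phi$. Assume that $\psi$ is bounded from below on $\operatorname{dom}\phi$, that $\phi$ is bounded from below by an affine function, and that $\nabla f\colon\mathbb X\to\mathbb X$ is locally Lipschitz continuous. Let $\{x^k\}$ be any (infinite) sequence generated by the Proximal Gradient Method (described in the context) applied to $\min_{x\in\mathbb X}\psi(x)$. Suppose that $\{x^k\}_K$ is a subsequence of $\{x^k\}$ converging to some limit point $x^*\in\mathbb X$, and that $\psi$ has the KL property at $x^*$. Then the entire sequence $\{x^k\}$ converges to $x^*$, and if the corresponding desingularization function has the form $\chi(t)=c\,t^{1/2}$ for some $c>0$, the following statements hold: (a) the sequence $\{\psi(x^k)\}$ converges Q-linearly to $\psi(x^* )$; (b) the sequence $\{x^k\}$ converges R-linearly to $x^*$.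
   Context: A Euclidean space is a real finite-dimensional Hilbert space, with inner product $\langle\cdot,\cdot\rangle$ and associated norm $\|\cdot\|$. For $\vartheta\colon\mathbb X\to\mathbb R\cup\{\infty\}$, $\operatorname{dom}\vartheta:=\{x\in\mathbb X\mid\vartheta(x)<\infty\}$. For a set $A\subset\mathbb X$, $\operatorname{dist}(x,A):=\inf\{\|y-x\|\mid y\in A\}$, with $\operatorname{dist}(x,\emptyset):=\infty$. Rates. A sequence $\{z^k\}$ in a Euclidean space (in particular in $\mathbb R$) converges Q-linearly to $z^*$ if there is a constant $q\in(0,1)$ such that $\|z^{k+1}-z^*\|\le q\|z^k-z^*\|$ for all sufficiently large $k\in\mathbb N$. It converges R-linearly to $z^*$ if $\limsup_{k\to\infty}\|z^k-z^*\|^{1/k}<1$. Proximal Gradient Method. Parameters: $\tau>1$, $0<\gamma_{\min}\le\gamma_{\max}<\infty$, $\delta\in(0,1)$, starting point $x^0\in\operatorname{dom}\phi$. In each iteration $k=0,1,2,\ldots$: choose $\gamma_k^0\in[\gamma_{\min},\gamma_{\max}]$; for $i=0,1,2,\ldots$, set $\gamma_{k,i}:=\tau^i\gamma_k^0$ and compute a (global) solution $x^{k,i}$ of $$\min_{x\in\mathbb X}\ f(x^k)+\langle\nabla f(x^k),x-x^k\rangle+\frac{\gamma_{k,i}}{2}\|x-x^k\|^2+\phi(x),$$ until the acceptance criterion $$\psi(x^{k,i})\le\psi(x^k)-\delta\frac{\gamma_{k,i}}{2}\|x^{k,i}-x^k\|^2$$ holds for the first time; let $i_k:=i$ be this terminal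 index, and set $\gamma_k:=\gamma_{k,i_k}$ and $x^{k+1}:=x^{k,i_k}$. It is assumed throughout that the method generates an infinite sequence (the inner loops all terminate and no outer termination criterion stops the method). Subdifferentials. For lower semicontinuous $\vartheta\colon\mathbb X\to\mathbb R\cup\{\infty\}$ and $x\in\operatorname{dom}\vartheta$, the regular subdifferential is $$\widehat\partial\vartheta(x):=\Big\{\eta\in\mathbb X\ \Big|\ \liminf_{y\to x,\,y\ne x}\frac{\vartheta(y)-\vartheta(x)-\langle\eta,y-x\rangle}{\|y-x\|}\ge0\Big\},$$ and the limiting (Mordukhovich) subdifferential $\partial\vartheta(x)$ is the set of all $\eta\in\mathbb X$ for which there exist sequences $x^k\to x$ and $\eta^k\to\eta$ with $\vartheta(x^k)\to\vartheta(x)$ and $\eta^k\in\widehat\partial\vartheta(x^k)$ for all $k$. For $x\notin\operatorname{dom}\vartheta$ these sets are empty. KL property. A lower semicontinuous $g\colon\mathbb X\to\mathbb R\cup\{\infty\}$ has the KL (Kurdyka–Łojasiewicz) property at a point $x^*$ with $\partial g(x^* )\ne\emptyset$ if there exist a constant $\eta>0$, a neighborhood $U\subset\mathbb X$ of $x^*$, and a continuous concave function $\chi\colon[0,\eta]\to[0,\infty)$, continuously differentiable on $(0,\eta)$, with $\chi(0)=0$ and $\chi'(t)>0$ for all $t\in(0,\eta)$, such that $$\chi'\big(g(x)-g(x^* )\big)\operatorname{dist}\big(0,\partial g(x)\big)\ge1$$ holds for all $x\in U\cap\{x\in\mathbb X\mid g(x^* )<g(x)<g(x^* )+\eta\}$.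 The function $\chi$ is called the desingularization function. *)

(* Defs.v *)
From HB Require Import structures.
From mathcomp Require Import all_boot all_order all_algebra.
From mathcomp Require Import all_classical all_reals all_analysis.

Set Implicit Arguments.
Unset Strict Implicit.
Unset Printing Implicit Defensive.

Import Order.TTheory GRing.Theory Num.Theory.
Import numFieldNormedType.Exports.

Local Open Scope classical_set_scope.
Local Open Scope ring_scope.

(* Completeness is not required separately: it is automatic in finite
   dimension. *)
HB.mixin Record NormedVector_isEuclidean (R : realType) X
    of NormedModule R X & Vector R X := {
  inner : {dot X for idfun};
  norm_inner : forall x : X, `|x| = Num.sqrt (inner x x)
}.

#[short(type="euclideanType")]
HB.structure Definition Euclidean (R : realType) :=
  {X of NormedModule R X & Vector R X & NormedVector_isEuclidean R X}.

Notation "'[ x , y ]" := (inner x y) : ring_scope.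

Definition dom (T : Type) (R : realType) (theta : T -> \bar R) : set T :=
  [set x | (theta x < +oo)%E].

(* [ereal_inf set0 = +oo], hence [dist x set0 = +oo]. *)
Definition dist (R : realType) (X : normedModType R) (x : X) (A : set X)
    : \bar R :=
  ereal_inf [set `|y - x|%:E | y in A].

Definition is_gradient (R : realType) (X : euclideanType R) (f : X -> R)
    (x g : X) : Prop :=
  differentiable f x /\ forall v : X, 'd f x v = '[g, v].

Definition locally_lipschitz (R : realType) (V W : normedModType R)
    (F : V -> W) : Prop :=
  forall x : V, exists2 U, nbhs x U & [lipschitz F y | y in U].

Definition q_linear (R : realType) (V : normedModType R) (z : nat -> V)
    (l : V) : Prop :=
  exists2 q : R, 0 < q < 1 &
    \forall k \near \oo, `|z k.+1 - l| <= q * `|z k - l|.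

Definition r_linear (R : realType) (V : normedModType R) (z : nat -> V)
    (l : V) : Prop :=
  (limn_esup (fun k => (`|z k - l| `^ k%:R^-1)%:E) < 1)%E.

Section Subdifferential.
Context {R : realType} {X : euclideanType R}.
Implicit Types (theta : X -> \bar R) (x : X).

Definition regular_subdiff theta x : set X :=
  [set eta | dom theta x /\
    (0 <= limf_einf (fun y : X =>
      (theta y - theta x - '[eta, y - x]%:E) * (`|y - x|^-1)%:E) x^')%E].

Definition limiting_subdiff theta x : set X :=
  [set eta | dom theta x /\ exists xs etas : nat -> X,
    [/\ xs @ \oo --> x, etas @ \oo --> eta,
        theta (xs k) @[k --> \oo] --> theta x &
        forall k, regular_subdiff theta (xs k) (etas k)]].

End Subdifferential.

Section KL.
Context {R : realType} {X : euclideanType R}.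
Implicit Types (g : X -> \bar R) (xs : X).

Definition desingularization (eta : R) (chi : R -> R) : Prop :=
  [/\ {within `[0, eta], continuous chi},
      convex_function `[0, eta] (\- chi : R^o -> R^o),
      forall t : R, 0 <= t <= eta -> 0 <= chi t,
      chi 0 = 0 &
      forall t : R, 0 < t < eta ->
        [/\ derivable chi t 1, {for t, continuous (derive1 chi)} & 0 < derive1 chi t]].

(* The values of [g] under [fine] below are finite: [g xs] because
   [limiting_subdiff g xs] is nonempty, [g x] by the two strict bounds. *)
Definition KL_with g xs (eta : R) (chi : R -> R) : Prop :=
  [/\ lower_semicontinuous g,
      limiting_subdiff g xs !=set0,
      0 < eta,
      desingularization eta chi &
      exists2 U, nbhs xs U &
        forall x, U x -> (g xs < g x < g xs + eta%:E)%E ->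
          (1 <= (derive1 chi (fine (g x) - fine (g xs)))%:E
                * dist 0%R (limiting_subdiff g x))%E].

Definition KL_property g xs : Prop := exists eta chi, KL_with g xs eta chi.

End KL.

Section ProximalGradient.
Context {R : realType} {X : euclideanType R}.
Variables (f : X -> R) (df : X -> X) (phi : X -> \bar R).

Definition objective (x : X) : \bar R := ((f x)%:E + phi x)%E.

Definition pg_model (xk : X) (gamma : R) (x : X) : \bar R :=
  ((f xk + '[df xk, x - xk] + gamma / 2 * `|x - xk| ^+ 2)%:E + phi x)%E.

Definition pg_accept (delta : R) (xk : X) (gamma : R) (x : X) : Prop :=
  (objective x <= objective xk - (delta * (gamma / 2) * `|x - xk| ^+ 2)%:E)%E.

(* [xt i] is the trial point of the inner iteration [i]; it is meaningful only
   up to the terminal index [ik]. *)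
Definition pg_step (tau gmin gmax delta : R) (xk xk1 : X) : Prop :=
  exists (gamma0 : R) (xt : nat -> X) (ik : nat),
    [/\ gmin <= gamma0 <= gmax,
        forall i, (i <= ik)%N -> forall y,
          (pg_model xk (tau ^+ i * gamma0) (xt i)
             <= pg_model xk (tau ^+ i * gamma0) y)%E,
        forall i, (i < ik)%N -> ~ pg_accept delta xk (tau ^+ i * gamma0) (xt i),
        pg_accept delta xk (tau ^+ ik * gamma0) (xt ik) &
        xk1 = xt ik].

Definition pg_sequence (tau gmin gmax delta : R) (x : nat -> X) : Prop :=
  dom phi (x 0%N) /\ forall k, pg_step tau gmin gmax delta (x k) (x k.+1).

End ProximalGradient.

(* Main.v *)
Require Import Defs.
From HB Require Import structures.
From mathcomp Require Import all_boot all_order all_algebra.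
From mathcomp Require Import all_classical all_reals all_analysis.
From mathcomp Require Import ring lra.

Set Implicit Arguments.
Unset Strict Implicit.
Unset Printing Implicit Defensive.

Import Order.TTheory GRing.Theory Num.Theory.
Import numFieldNormedType.Exports.

Local Open Scope classical_set_scope.
Local Open Scope ring_scope.

(** Write d_k for the length of the step from x_k to x_(k+1) and e_k for
    psi (x_k) - psi xs.  The method is a descent method with three properties.
    - Sufficient decrease: alpha d_k^2 <= e_k - e_(k+1) with
      alpha = delta gmin / 2.  This is the acceptance test.
    - Relative error: near xs, psi has at x_(k+1) a limiting subgradient of
      norm at most M d_k.  Fermat's rule for the subproblem provides the
      subgradient df x_(k+1) - df x_k - gamma_k (x_(k+1) - x_k), so that a local
      Lipschitz constant of df and an upper bound of gamma_k suffice.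
    - Values: psi (x_k) tends to psi xs.  Lower semicontinuity bounds the limit
      from below; comparing x_(k+1) with xs in the subproblem bounds it from
      above.

    The upper bound of gamma_k rests on a Lipschitz constant of df near xs only
    (large_gamma_accepted).  Let x_k be close to xs.  A minimizer of the
    subproblem for a large gamma cannot be far from x_k, because phi has an
    affine minorant and psi (x_k) <= psi (x_0); hence it lies in the ball where
    df is Lipschitz, and there the descent lemma gives the acceptance test.  A
    rejected parameter is therefore bounded, and gamma_k is at most gmax or is
    tau times a rejected one.

    Convergence follows from the three properties and the KL inequality by a
    length argument.  Concavity of chi bounds the drop of chi (e_k) from below by
    chi' (e_k) (e_k - e_(k+1)); with the KL inequality and the properties above,
    2 d_(k+1) <= d_k + (M / alpha) (chi (e_(k+1)) - chi (e_(k+2)))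
    as long as x_k and x_(k+1) are near xs (KL_step_length).  Summing telescopes:
    the path from x_(m+1) on has length at most
    d_m + (M / alpha) chi (e_(m+1)), which is small when m is a late index of
    the subsequence.  So the iterates never leave the ball in which the estimate
    holds, and as the ball may be taken as small as desired, the whole sequence
    converges (KL_descent_cvg).

    For chi t = c sqrt t, the tangent inequality between 0 and t reads
    t chi' t <= c sqrt t.  Combined with the KL inequality it yields
    e_(k+1) <= (c M d_k)^2 <= A (e_k - e_(k+1)) with A = (c M)^2 / alpha, that is
    e_(k+1) <= A / (1 + A) e_k.  The steps then decay geometrically, because
    alpha d_k^2 <= e_k, and so does the distance to the limit. *)

(** * Inner product, gradients and local Lipschitz continuity *)

Section Inner.
Context {R : realType} {X : euclideanType R}.
Implicit Types u v w : X.

Lemma innerC u v : '[u, v] = '[v, u].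
Proof. by rewrite hermC expr0 mul1r. Qed.

Lemma inner_norm u : '[u, u] = `|u| ^+ 2.
Proof.
have [->|u0] := eqVneq u 0; first by rewrite linear0l normr0 expr0n.
by rewrite norm_inner sqr_sqrtr // ltW // neq0_dnorm_gt0.
Qed.

Lemma normD_sqr u v : `|u + v| ^+ 2 = `|u| ^+ 2 + 2 * '[u, v] + `|v| ^+ 2.
Proof.
rewrite -!inner_norm linearDl /= !linearDr /= (innerC v u).
by ring.
Qed.

(** Cauchy-Schwarz comes from the triangle inequality, which is part of the
    normed module structure: square it and cancel. *)
Lemma inner_le_norm u v : '[u, v] <= `|u| * `|v|.
Proof.
have : `|u + v| ^+ 2 <= (`|u| + `|v|) ^+ 2.
  by rewrite lerXn2r ?nnegrE ?addr_ge0 // ler_normD.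
by rewrite normD_sqr sqrrD; lra.
Qed.

End Inner.

Lemma locally_lipschitz_ball (R : realType) (V W : normedModType R)
    (F : V -> W) (a : V) : locally_lipschitz F ->
  exists L r : R, [/\ 0 < L, 0 < r &
    forall y z, ball a r y -> ball a r z -> `|F y - F z| <= L * `|y - z|].
Proof.
move=> /(_ a)[U /nbhs_ballP[r /= r0 aU] [M [Mreal FM]]].
exists (Num.max M 0 + 1), r; split => //.
  by rewrite ltr_wpDl // le_max lexx orbT.
move=> y z ay az; apply: (FM _ _ (y, z)); last by split; exact: aU.
by rewrite ltr_pwDr // le_max lexx.
Qed.

Section Gradient.
Context {R : realType} {X : euclideanType R}.
Implicit Types (f : X -> R) (df : X -> X).

Lemma gradient_near f (a g : X) : is_gradient f a g -> forall e, 0 < e ->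
  \forall y \near a, `|f y - f a - '[g, y - a]| <= e * `|y - a|.
Proof.
move=> [fa fg] e e0.
have /eqaddoP/(_ e e0) := diff_locally fa.
rewrite [X in _ -> X](near_shift 0) subr0.
apply: filterS => h /=; rewrite !fctE /= -fg.
by rewrite addrK opprD addrA.
Qed.

Lemma gradient_along_line f df (a d : X) (t : R) :
  (forall y, is_gradient f y (df y)) ->
  is_derive t (1 : R) (fun s : R => f (a + s *: d)) '[df (a + t *: d), d].
Proof.
move=> fdf; have [fd fE] := fdf (a + t *: d).
have linediff := is_diffD (is_diff_cst a t) (is_diff_scalel t d).
have fdiff := is_diff_comp linediff (differentiableP fd).
apply: DeriveDef; first exact/derivable1_diffP/ex_diff.
rewrite deriveE; last exact: ex_diff.
by rewrite (diff_val (is_diff_def := fdiff)) /= !fctE /= add0r scale1r fE.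
Qed.

(** The constant is L rather than L / 2 because the mean value theorem evaluates
    df at one point of the segment, which is no further from x than y is. *)
Lemma descent_lemma f df (a : X) (L r : R) (x y : X) :
  (forall z, is_gradient f z (df z)) -> 0 < L ->
  (forall y z, ball a r y -> ball a r z -> `|df y - df z| <= L * `|y - z|) ->
  ball a r x -> ball a r y ->
  f y <= f x + '[df x, y - x] + L * `|y - x| ^+ 2.
Proof.
move=> fdf L0 dfL ax ay.
have gD s := gradient_along_line x (y - x) s fdf.
have [|t + ft] := MVT ltr01 (fun s _ => gD s).
  apply: continuous_subspaceT => s.
  exact/differentiable_continuous/derivable1_diffP.
rewrite in_itv /= => /andP[t0 t1].
have az : ball a r (x + t *: (y - x)).
  move: ax ay; rewrite -!ball_normE /= => ax ay.
  have -> : a - (x + t *: (y - x)) = (1 - t) *: (a - x) + t *: (a - y).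
    rewrite scalerBl scale1r -addrA [- _ + _]addrC -scalerBr opprD addrA.
    congr (_ + _); rewrite -scalerN opprB; congr (_ *: _).
    by rewrite opprB [RHS]addrC addrA subrK.
  have := ler_normD ((1 - t) *: (a - x)) (t *: (a - y)).
  rewrite !normrZ !ger0_norm; [nra|lra|lra].
have := inner_le_norm (df (x + t *: (y - x)) - df x) (y - x).
have := dfL _ _ az ax.
rewrite addrAC subrr add0r normrZ ger0_norm; last lra.
move: ft; rewrite scale1r scale0r addr0 subr0 mulr1 addrCA subrr addr0.
rewrite linearBl /= => ft.
have : 0 <= `|y - x| by [].
move: `|y - x| `|_ - df x| => n m n0.
move=> m_le; have : m <= L * n
  by have : 0 <= L * n * (1 - t); [rewrite !mulr_ge0 ?subr_ge0 // ltW|lra].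
by move=> mLn ?; have := ler_wpM2r n0 mLn; lra.
Qed.
End Gradient.

(** * Desingularization functions and R-linear convergence *)

(** Concavity bounds every left difference quotient of chi at b by the slope
    of the chord from a to b; the derivative at b is the limit of these. *)
Lemma concave_le_tangent (R : realType) (eta : R) (chi : R -> R) (a b : R) :
  desingularization eta chi -> 0 <= a -> a < b -> b < eta ->
  derive1 chi b * (b - a) <= chi b - chi a.
Proof.
move=> [_ chiconc _ _ chid] a0 ab beta.
have b0 : 0 < b by exact: le_lt_trans ab.
have [|db _ _] := chid b; first by rewrite b0.
rewrite -ler_pdivlMr ?subr_gt0 // derive1E.
have dl : h^-1 *: ((chi \o shift b) (h *: 1) - chi b) @[h --> 0^'-] --> 'D_1 chi b.
  exact: cvg_dnbhs_at_left db.
rewrite -(cvg_lim _ dl) //; apply: limr_le; first by apply/cvg_ex; eexists; exact: dl.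
near=> h.
have h0 : h < 0 by near: h; exact: nbhs_left_lt.
have hab : a - b < h by near: h; apply: nbhs_left_gt; rewrite subr_lt0.
have s0 : 0 <= - h / (b - a) by rewrite divr_ge0 // ?oppr_ge0 ?subr_ge0 ltW.
have s1 : - h / (b - a) <= 1 by rewrite ler_pdivrMr ?subr_gt0 //; lra.
have bI : b \in [set` `[0, eta]] by rewrite inE /= in_itv /=; apply/andP; split; lra.
have aI : a \in [set` `[0, eta]] by rewrite inE /= in_itv /=; apply/andP; split; lra.
have := chiconc (Itv01 s0 s1) a b aI bI.
rewrite [X in (\- chi) X](_ : _ = h + b); last first.
  rewrite [LHS]convRE /= /unstable.onem; field.
  by rewrite subr_eq0 gt_eqF.
rewrite convRE /= /unstable.onem /GRing.scale /= mulr1 => cc.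
rewrite ler_ndivrMl // mulrC.
have -> : (chi b - chi a) / (b - a) * h = - (- h / (b - a) * (chi b - chi a)) by ring.
lra.
Unshelve. all: by end_near. Qed.

(** The constant D disappears in the k-th root: a ratio s' strictly between s
    and 1 absorbs it from some index on. *)
Lemma r_linear_geometric (R : realType) (V : normedModType R) (z : nat -> V)
    (l : V) (D s : R) : 0 < s < 1 ->
  (\forall k \near \oo, `|z k - l| <= D * s ^+ k) -> r_linear z l.
Proof.
move=> /andP[s0 s1] zD.
pose s' := (1 + s) / 2.
have ss' : 0 < s / s' < 1.
  by rewrite divr_gt0 /s' ?ltr_pdivrMr /=; lra.
have s'01 : 0 < s' < 1 by rewrite /s'; apply/andP; split; lra.
have zs' : \forall k \near \oo, `|z k - l| <= s' ^+ k.
  have : (s / s') ^+ k @[k --> \oo] --> 0.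
    by apply: cvg_expr; rewrite ger0_norm; lra.
  have D0 : 0 < (`|D| + 1)^-1 by rewrite invr_gt0 ltr_wpDl.
  move=> /cvgrPdist_le /(_ _ D0) small.
  near=> k; apply: (@le_trans _ _ (D * s ^+ k)); first by near: k.
  have : `|0 - (s / s') ^+ k| <= (`|D| + 1)^-1 by near: k.
  have sk0 : 0 <= s ^+ k by rewrite exprn_ge0 // ltW.
  have s'k0 : 0 < s' ^+ k by rewrite exprn_gt0 //; lra.
  rewrite sub0r normrN expr_div_n ger0_norm; last by rewrite divr_ge0 // ltW.
  rewrite ler_pdivrMr // mulrC ler_pdivlMr ?ltr_wpDl // => small_k.
  apply: le_trans small_k; rewrite mulrC; apply: ler_wpM2l => //.
  by apply: le_trans (ler_norm D) _; rewrite lerDl.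
have s'1 : (s'%:E < 1%:E)%E by rewrite lte_fin; lra.
rewrite /r_linear; apply: le_lt_trans s'1; rewrite /limn_esup limf_esupE.
apply: ge_ereal_inf; exists (ereal_sup [set (`|z k - l| `^ k%:R^-1)%:E | k in
  [set k | (0 < k)%N /\ `|z k - l| <= s' ^+ k]]).
  exists [set k | (0 < k)%N /\ `|z k - l| <= s' ^+ k] => //.
  near=> k; split; last by near: k.
  by near: k; exists 1%N.
apply: ge_ereal_sup => _ [k [k0 zk] <-]; rewrite lee_fin.
have s'k0 : 0 <= s' ^+ k by rewrite exprn_ge0 //; lra.
have k1 : 0 <= k%:R^-1 :> R by rewrite invr_ge0.
apply: le_trans (ge0_ler_powR k1 _ _ zk) _; rewrite ?nnegrE //.
rewrite -powR_mulrn -?powRrM; last lra.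
by rewrite divff ?powRr1 ?pnatr_eq0 -?lt0n //; lra.
Unshelve. all: by end_near. Qed.

(** * Descent sequences under the KL property *)

Section KLDescent.
Context {R : realType} {X : euclideanType R}.
Variables (psi : X -> \bar R) (x : nat -> X) (xs : X) (p : nat -> R) (ps : R).
Variables (alpha M rho : R).
Hypotheses (psiE : forall k, psi (x k) = (p k)%:E) (psisE : psi xs = ps%:E).
Hypotheses (alpha_gt0 : 0 < alpha) (M_gt0 : 0 < M) (rho_gt0 : 0 < rho).
Hypothesis decrease : forall k, alpha * `|x k.+1 - x k| ^+ 2 <= p k - p k.+1.
Hypothesis slope : forall k, ball xs rho (x k) -> ball xs rho (x k.+1) ->
  (dist 0%R (limiting_subdiff psi (x k.+1)) <= (M * `|x k.+1 - x k|)%:E)%E.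
Hypothesis p_cvg : p @ \oo --> ps.

Let p_nonincreasing : nonincreasing_seq p.
Proof.
apply/nonincreasing_seqP => k; rewrite -subr_ge0.
by apply: le_trans (decrease k); rewrite mulr_ge0 ?exprn_ge0 // ltW.
Qed.

Let p_ge k : ps <= p k.
Proof.
rewrite -(cvg_lim _ p_cvg) //; apply: nonincreasing_cvgn_ge => //.
by apply/cvg_ex; exists ps.
Qed.

Lemma KL_slope eta chi : KL_with psi xs eta chi ->
  exists2 r, 0 < r & forall k, ball xs r (x k) -> ball xs r (x k.+1) ->
    ps < p k.+1 -> p k.+1 - ps < eta ->
    1 <= derive1 chi (p k.+1 - ps) * (M * `|x k.+1 - x k|).
Proof.
move=> [_ _ eta0 [_ _ _ _ chid] [U /nbhs_ballP[r /= r0 rU] KL]].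
exists (Num.min r rho); first by rewrite lt_min r0.
move=> k xk xk1 psk pketa.
have [|_ _ chi'0] := chid (p k.+1 - ps); first by rewrite subr_gt0 psk.
have rk y : ball xs (Num.min r rho) y -> ball xs r y /\ ball xs rho y.
  by move=> ry; split; apply: le_ball ry; rewrite ge_min lexx ?orbT.
have := KL (x k.+1) (rU _ (rk _ xk1).1).
rewrite psiE psisE -EFinD !lte_fin psk -ltrBlDl pketa => /(_ isT) /=.
rewrite -lee_fin EFinM => /le_trans; apply.
rewrite lee_pmul2l ?lte_fin //.
by apply: slope; apply: (rk _ _).2.
Qed.

(** With D the drop of chi, the tangent inequality and the KL inequality give
    alpha d'^2 <= M d D for consecutive step lengths d and d'; the
    arithmetic-geometric mean inequality makes this linear. *)
Lemma KL_step_length eta chi : KL_with psi xs eta chi ->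
  exists2 r, 0 < r & forall k, ball xs r (x k) -> ball xs r (x k.+1) ->
    p k.+1 - ps < eta ->
    2 * `|x k.+2 - x k.+1| <= `|x k.+1 - x k| +
      M / alpha * (chi (p k.+1 - ps) - chi (p k.+2 - ps)).
Proof.
move=> KL; have [r r0 slopeKL] := KL_slope KL.
have [_ _ _ desing _] := KL; have [_ _ _ _ chid] := desing.
exists r => // k xk xk1 pketa.
have := decrease k.+1; have := p_ge k.+2; have := slopeKL k xk xk1.
have d0 : 0 <= `|x k.+1 - x k| by [].
have d'0 : 0 <= `|x k.+2 - x k.+1| by [].
(* If the value does not drop, sufficient decrease forces the step to vanish;
   this includes the case in which the value psi xs has been reached. *)
have [pk2|pk2] := ltP (p k.+2) (p k.+1); last first.
  have -> : p k.+2 = p k.+1.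
    by apply/le_anti; rewrite pk2 andbT; apply: p_nonincreasing.
  rewrite !subrr mulr0 pmulr_rle0 // => _ _ d'sq.
  have /eqP -> : `|x k.+2 - x k.+1| == 0.
    by rewrite -sqrf_eq0 eq_le d'sq sqr_ge0.
  by rewrite mulr0 addr0.
move=> + ps2 decr => /(_ (le_lt_trans ps2 pk2) pketa).
have a0 : 0 <= p k.+2 - ps by rewrite subr_ge0.
have ab : p k.+2 - ps < p k.+1 - ps by rewrite ltrD2r.
have := concave_le_tangent desing a0 ab pketa.
have -> : p k.+1 - ps - (p k.+2 - ps) = p k.+1 - p k.+2 by ring.
have [|_ _] := chid (p k.+1 - ps); first by rewrite pketa (le_lt_trans a0).
move: (chi _ - chi _) (derive1 chi _) => D g g0 tangent KLk.
move: d0 d'0 decr KLk.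
set d := `|x k.+1 - x k|; set d' := `|_ - _| => d0 d'0 decr KLk.
have gDp : alpha * d' ^+ 2 * g <= D.
  apply: le_trans tangent; rewrite mulrC ler_pM2l //; lra.
have Dd : alpha * d' ^+ 2 <= M * d * D.
  have sq0 : 0 <= alpha * d' ^+ 2 by rewrite mulr_ge0 ?exprn_ge0 // ltW.
  have Md0 : 0 <= M * d by rewrite mulr_ge0 // ltW.
  have := ler_wpM2l sq0 KLk; have := ler_wpM2l Md0 gDp.
  lra.
have D0 : 0 <= D.
  by apply: le_trans gDp; rewrite !mulr_ge0 ?exprn_ge0 // ltW.
set E := M / alpha * D.
have E0 : 0 <= E by rewrite mulr_ge0 // divr_ge0 // ltW.
have dE : d' ^+ 2 <= d * E.
  rewrite -(ler_pM2l alpha_gt0) (_ : alpha * (d * E) = M * d * D) // /E.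
  by field; rewrite gt_eqF.
have : (2 * d') ^+ 2 <= (d + E) ^+ 2 by have := sqr_ge0 (d - E); nra.
by rewrite ler_pXn2r // nnegrE ?mulr_ge0 ?addr_ge0.
Qed.

Lemma desingularization_cvg0 eta chi : 0 < eta -> desingularization eta chi ->
  chi (p k - ps) @[k --> \oo] --> 0.
Proof.
move=> eta0 [/subspace_continuousP chic _ _ chi0 _].
have /chic : `[0, eta]%classic 0 by rewrite /= in_itv /= lexx ltW.
rewrite /from_subspace chi0; apply: cvg_comp => A /= A0.
have pps : p k - ps @[k --> \oo] --> 0.
  by rewrite -[0](subrr ps); apply: cvgB => //; exact: cvg_cst.
have small : \forall k \near \oo, p k - ps < eta by apply: (cvgr_lt _ pps).
have inA : \forall k \near \oo, `[0, eta]%classic (p k - ps) -> A (p k - ps).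
  exact: pps _ A0.
apply: filterS2 inA small => k /= + keta; apply.
by rewrite in_itv /= subr_ge0 p_ge ltW.
Qed.

Lemma step_cvg0 : `|x k.+1 - x k| @[k --> \oo] --> 0.
Proof.
have pp : p k - p k.+1 @[k --> \oo] --> 0.
  rewrite -[0](subrr ps); apply: cvgB => //.
  by rewrite (cvg_shiftS p).
apply/cvgr0Pnorm_lt => e e0.
have : \forall k \near \oo, p k - p k.+1 < alpha * e ^+ 2.
  by apply: (cvgr_lt _ pp _); rewrite mulr_gt0 ?exprn_gt0.
apply: filterS => k pk; rewrite normr_id.
have := le_lt_trans (decrease k) pk.
by rewrite ltr_pM2l // ltr_pXn2r // nnegrE // ltW.
Qed.

(** Starting from a late index m at which x_m is close to xs, KL_step_length
    may be summed: the bound on the path length after m keeps the path inside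
    the ball in which KL_step_length holds, so the induction never stops. The
    radius is arbitrary, hence the conclusion is convergence to xs itself. *)
Lemma KL_descent_cvg (sigma : nat -> nat) :
  {homo sigma : m n / (m < n)%N} -> x (sigma n) @[n --> \oo] --> xs ->
  KL_property psi xs -> x @ \oo --> xs.
Proof.
move=> sigma_incr x_sub [eta [chi KL]].
have [r r0 stepKL] := KL_step_length KL.
have [_ _ eta0 desing _] := KL; have [_ _ chi_ge0 _ _] := desing.
apply/cvgrPdist_lt => e e0.
set C := M / alpha in stepKL; have C0 : 0 < C by rewrite divr_gt0.
(* Four quantities of size q make up the distance from xs to an iterate: the
   distance from xs to x_m, the step after m twice, and the drop of chi. *)
pose q := Num.min r e / 4.
have q0 : 0 < q by rewrite divr_gt0 // lt_min r0.
have qr : 4 * q <= r by rewrite /q mulrC divfK ?pnatr_eq0 // ge_min lexx.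
have qe : 4 * q <= e by rewrite /q mulrC divfK ?pnatr_eq0 // ge_min lexx orbT.
have sigma_ge n : (n <= sigma n)%N.
  by elim: n => // n IH; apply: leq_ltn_trans IH (sigma_incr _ _ _).
have late : \forall k \near \oo, [/\ p k.+1 - ps < eta, `|x k.+1 - x k| < q &
    C * chi (p k.+1 - ps) < q].
  have pps : p k - ps @[k --> \oo] --> 0.
    by rewrite -[0](subrr ps); apply: cvgB => //; exact: cvg_cst.
  have chi0 : C * chi (p k - ps) @[k --> \oo] --> 0.
    by rewrite -[0](mulr0 C); exact: cvgMl_tmp (desingularization_cvg0 eta0 desing).
  move: pps chi0; rewrite -cvg_shiftS -[X in _ -> X -> _]cvg_shiftS /= => pps chi0.
  near=> k; split; near: k.
  - exact: (cvgr_lt _ pps _).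
  - exact: (cvgr_lt _ step_cvg0 _).
  - exact: (cvgr_lt _ chi0 _).
have [N _ lateN] := late.
have [n [nN xn]] : exists n, (N <= n)%N /\ `|xs - x (sigma n)| < q.
  have [N' _ closeN'] := cvgr_dist_lt _ _ x_sub _ q0.
  by exists (maxn N N'); split; [exact: leq_maxl | apply: closeN'; exact: leq_maxr].
set m := sigma n in xn.
have mN : (N <= m)%N by exact: leq_trans nN (sigma_ge n).
have {}late k : (m <= k)%N -> [/\ p k.+1 - ps < eta, `|x k.+1 - x k| < q &
    C * chi (p k.+1 - ps) < q] by move=> mk; apply: lateN; apply: leq_trans mk.
have chi_ge0' k : (m <= k)%N -> 0 <= C * chi (p k.+1 - ps).
  move=> /late[peta _ _]; rewrite mulr_ge0 ?(ltW C0) // chi_ge0 //.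
  by rewrite subr_ge0 p_ge ltW.
have [_ dm chim] := late m (leqnn m).
(* The last step length stays on the left-hand side because the next use of
   KL_step_length consumes it. *)
have stays j : [/\ `|xs - x (m + j)| < 4 * q, `|xs - x (m + j).+1| < 4 * q &
    `|x (m + j).+1 - x m.+1| + `|x (m + j).+1 - x (m + j)| <=
    `|x m.+1 - x m| + C * (chi (p m.+1 - ps) - chi (p (m + j).+1 - ps))].
  have xm1 : `|xs - x m.+1| < 2 * q.
    by have := ler_distD (x m) xs (x m.+1); rewrite (distrC (x m)); lra.
  elim: j => [|j [xj xj1 IH]].
    by rewrite addn0 !subrr mulr0 normr0 add0r addr0; split => //; lra.
  rewrite addnS.
  have [peta _ _] := late (m + j)%N (leq_addr _ _).
  have := stepKL (m + j)%N; rewrite -ball_normE /= => step.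
  have {}step := step (lt_le_trans xj qr) (lt_le_trans xj1 qr) peta.
  have tri := ler_distD (x (m + j).+1) (x (m + j).+2) (x m.+1).
  have bound : `|x (m + j).+2 - x m.+1| + `|x (m + j).+2 - x (m + j).+1| <=
    `|x m.+1 - x m| + C * (chi (p m.+1 - ps) - chi (p (m + j).+2 - ps)) by lra.
  split => //.
  have := chi_ge0' (m + j).+1 (leqW (leq_addr _ _)).
  have := ler_distD (x m.+1) xs (x (m + j).+2).
  rewrite (distrC (x m.+1)).
  have : 0 <= `|x (m + j).+2 - x (m + j).+1| by [].
  lra.
exists m => // k /= mk; have [+ _ _] := stays (k - m)%N.
by rewrite subnKC // => /lt_le_trans; apply.
Unshelve. all: by end_near. Qed.

(** The tangent inequality with left endpoint 0 bounds t chi' t by c sqrt t,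
    so the KL inequality turns into e_(k+1) <= (c M d_k)^2, and sufficient
    decrease bounds d_k^2 by the decrease of e. *)
Lemma KL_sqrt_q_linear eta c chi : x @ \oo --> xs -> KL_with psi xs eta chi ->
  0 < c -> (forall t, 0 <= t <= eta -> chi t = c * t `^ 2^-1) ->
  q_linear p ps.
Proof.
move=> x_cvg KL c0 chiE; have [r r0 slopeKL] := KL_slope KL.
have [_ _ eta0 desing _] := KL.
pose A := (c * M) ^+ 2 / alpha.
have A0 : 0 < A by rewrite divr_gt0 // exprn_gt0 // mulr_gt0.
have A1 : 0 < 1 + A by lra.
exists (A / (1 + A)); first by rewrite divr_gt0 //= ltr_pdivrMr //; lra.
have pps : p k - ps @[k --> \oo] --> 0.
  by rewrite -[0](subrr ps); apply: cvgB => //; exact: cvg_cst.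
have x_near : \forall k \near \oo, ball xs r (x k) by exact: cvg_ball.
have x_near1 : \forall k \near \oo, ball xs r (x k.+1).
  by move: x_cvg; rewrite -cvg_shiftS => x_cvg; exact: cvg_ball.
have eta_near : \forall k \near \oo, p k.+1 - ps < eta.
  by move: pps; rewrite -cvg_shiftS => pps; apply: (cvgr_lt _ pps _).
near=> k.
have e0 : 0 <= p k - ps by rewrite subr_ge0.
have e1 : 0 <= p k.+1 - ps by rewrite subr_ge0.
rewrite !ger0_norm // mulrAC ler_pdivlMr //.
suff : p k.+1 - ps <= A * (p k - p k.+1) by lra.
have decr := decrease k.
have [pk1|pk1] := leP (p k.+1) ps.
  have -> : p k.+1 = ps by apply/le_anti; rewrite pk1 p_ge.
  by rewrite subrr mulr_ge0 // ltW.
have keta : p k.+1 - ps < eta by near: k.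
have slopek : 1 <= derive1 chi (p k.+1 - ps) * (M * `|x k.+1 - x k|).
  by apply: slopeKL => //; near: k.
move: decr slopek; set d := `|_ - _| => decr slopek.
have d0 : 0 <= d by exact: normr_ge0.
have b0 : 0 < p k.+1 - ps by rewrite subr_gt0.
have := concave_le_tangent desing (lexx 0) b0 keta.
have -> : chi 0 = 0 by have [_ _ _ chi0 _] := desing.
rewrite !subr0 chiE; last by rewrite e1 ltW.
rewrite powR12_sqrt //.
move: slopek; set b := p k.+1 - ps; set g := derive1 chi b => slopek tangent.
have sb : 0 < Num.sqrt b by rewrite sqrtr_gt0.
have bE : b = Num.sqrt b ^+ 2 by rewrite sqr_sqrtr // ltW.
have sb_le : Num.sqrt b <= c * M * d.
  rewrite -(ler_pM2l sb) -expr2 -bE.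
  have Md0 : 0 <= M * d by rewrite mulr_ge0 // ltW.
  have := ler_wpM2l Md0 tangent; have := ler_wpM2l (ltW b0) slopek.
  rewrite -/b; lra.
have : b <= (c * M) ^+ 2 * d ^+ 2.
  rewrite {1}bE -exprMn lerXn2r ?nnegrE ?mulr_ge0 // ?ltW //.
move=> /le_trans; apply.
have -> : (c * M) ^+ 2 * d ^+ 2 = A * (alpha * d ^+ 2).
  by rewrite /A; field; rewrite gt_eqF.
by rewrite ler_pM2l.
Unshelve. all: by end_near. Qed.

(** The squared step is at most (p k - ps) / alpha, so the ratio of the steps
    is the square root of the ratio of the values. *)
Lemma q_linear_geometric : q_linear p ps ->
  exists s D : R, [/\ 0 < s < 1, 0 <= D &
    \forall k \near \oo, `|x k.+1 - x k| <= D * s ^+ k].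
Proof.
move=> [q /andP[q0 q1] [N _ pq]].
exists (Num.sqrt q), (Num.sqrt ((p N - ps) / q ^+ N / alpha)).
split => //.
  by rewrite sqrtr_gt0 q0 /= -[ltRHS]sqrtr1 ltr_sqrt.
exists N => // k /= Nk.
have geo j : p (N + j) - ps <= (p N - ps) * q ^+ j.
  elim: j => [|j IH]; first by rewrite addn0 expr0 mulr1.
  rewrite addnS exprS; have := pq (N + j)%N (leq_addr _ _).
  rewrite !ger0_norm ?subr_ge0 // => /le_trans; apply.
  by rewrite mulrCA ler_pM2l.
have qN : 0 < q ^+ N by rewrite exprn_gt0.
have pN : 0 <= p N - ps by rewrite subr_ge0.
rewrite -(@ler_pXn2r _ 2) ?nnegrE ?mulr_ge0 ?exprn_ge0 ?sqrtr_ge0 //.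
rewrite exprMn sqr_sqrtr ?divr_ge0 ?(ltW alpha_gt0) ?(ltW qN) //.
rewrite -exprM mulnC exprM sqr_sqrtr ?(ltW q0) //.
rewrite mulrAC ler_pdivlMr // mulrC.
apply: le_trans (decrease k) _; apply: (@le_trans _ _ (p k - ps)).
  by rewrite lerD2l lerN2.
have := geo (k - N)%N; rewrite subnKC // => /le_trans; apply.
rewrite -mulrA ler_wpM2l //.
rewrite mulrC ler_pdivlMr // -exprD subnK //.
Qed.

Lemma q_linear_r_linear : x @ \oo --> xs -> q_linear p ps -> r_linear x xs.
Proof.
move=> x_cvg /q_linear_geometric[s [D [s01 D0 [N _ stepD]]]].
have /andP[s0 s1] := s01.
apply: (@r_linear_geometric _ _ _ _ (D / (1 - s)) s s01).
exists N => // k /= Nk.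
have C0 : 0 <= D / (1 - s) by rewrite divr_ge0 // subr_ge0 ltW.
(* A geometric term is a difference of two terms of the geometric sequence
   divided by 1 - s, so the bounds on the steps telescope. *)
have tail j : `|x (k + j) - x k| <= D / (1 - s) * (s ^+ k - s ^+ (k + j)).
  elim: j => [|j IH]; first by rewrite addn0 !subrr normr0 mulr0.
  rewrite addnS.
  have := ler_distD (x (k + j)) (x (k + j).+1) (x k).
  have := stepD (k + j)%N (leq_trans Nk (leq_addr _ _)).
  have -> : D * s ^+ (k + j) = D / (1 - s) * (s ^+ (k + j) - s ^+ (k + j).+1).
    by rewrite exprS; field; rewrite subr_eq0 gt_eqF.
  lra.
have tail_cvg : `|x k - x n| @[n --> \oo] --> `|x k - xs|.
  by apply: cvg_norm; apply: cvgB => //; exact: cvg_cst.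
rewrite -(cvg_lim _ tail_cvg) //; apply: limr_le.
  by apply/cvg_ex; eexists; exact: tail_cvg.
exists k => // n /= kn; have := tail (n - k)%N; rewrite subnKC // distrC.
move=> /le_trans; apply; rewrite ler_wpM2l // lerBlDr lerDl exprn_ge0 //.
exact: ltW.
Qed.
End KLDescent.

(** * Subproblems of the proximal gradient method *)

Section ProximalStep.
Context {R : realType} {X : euclideanType R}.
Variables (f : X -> R) (df : X -> X) (phi : X -> \bar R).
Hypothesis phi_NNy : forall y, phi y != -oo%E.
Implicit Types (u v w z : X) (gamma : R).

Lemma dom_fineK z : dom phi z -> (fine (phi z))%:E = phi z.
Proof. by move=> domz; rewrite fineK // fin_numElt ltNye phi_NNy. Qed.

Lemma objective_fineE z : dom phi z ->
  objective f phi z = (f z + fine (phi z))%:E.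
Proof. by move=> domz; rewrite /objective -dom_fineK. Qed.

Lemma dom_objective z : dom (objective f phi) z <-> dom phi z.
Proof.
rewrite /dom /objective /=; have := phi_NNy z.
by case: (phi z) => [r| |] //= _; rewrite ?addey // !ltry.
Qed.

Definition pg_minimizer u gamma z :=
  forall y, (pg_model f df phi u gamma z <= pg_model f df phi u gamma y)%E.

Lemma pg_minimizer_dom u gamma z :
  dom phi u -> pg_minimizer u gamma z -> dom phi z.
Proof.
move=> domu /(_ u); rewrite /dom /= /pg_model -(dom_fineK domu) -EFinD => h.
have := le_lt_trans h (ltry _).
by have := phi_NNy z; case: (phi z) => [r| |] //= _; rewrite ?ltry // addey.
Qed.

Lemma pg_minimizer_fine u gamma z y :
  pg_minimizer u gamma z -> dom phi z -> dom phi y ->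
  '[df u, z - u] + gamma / 2 * `|z - u| ^+ 2 + fine (phi z) <=
  '[df u, y - u] + gamma / 2 * `|y - u| ^+ 2 + fine (phi y).
Proof.
move=> /(_ y) + domz domy.
rewrite /pg_model -(dom_fineK domz) -(dom_fineK domy) -!EFinD lee_fin /=; lra.
Qed.

Lemma pg_accept_fine delta u gamma z : dom phi u -> dom phi z ->
  pg_accept f phi delta u gamma z <->
  f z + fine (phi z) <=
    f u + fine (phi u) - delta * (gamma / 2) * `|z - u| ^+ 2.
Proof.
by move=> domu domz; rewrite /pg_accept !objective_fineE // -EFinB lee_fin.
Qed.

(** Fermat's rule for the subproblem. Expanding the squared norm of y - u
    around z, minimality gives a lower bound of phi y - phi z whose defect is
    gamma / 2 times the squared norm of y - z; adding the first-order
    expansion of f at z leaves a defect that is small with respect to the norm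
    of y - z. *)
Lemma pg_minimizer_subdiff u gamma z : 0 <= gamma ->
  is_gradient f z (df z) -> pg_minimizer u gamma z -> dom phi z ->
  regular_subdiff (objective f phi) z (df z - df u - gamma *: (z - u)).
Proof.
move=> gamma0 fz zmin domz; set w := _ - gamma *: _; split; first exact/dom_objective.
set F := (X in limf_einf X).
rewrite limf_einfE; apply/lee_addgt0Pr => e e0.
rewrite -leeBlDr // sub0e -EFinN.
pose V := [set y | y <> z /\ (gamma * `|y - z| <= e /\
  `|f y - f z - '[df z, y - z]| <= e / 2 * `|y - z|)].
apply: le_ereal_sup_tmp; exists (ereal_inf [set F y | y in V]).
  exists V => //.
  have g1 : 0 < gamma + 1 by rewrite ltr_wpDl.
  have e2 : 0 < e / 2 by rewrite divr_gt0.
  have zball : \forall y \near z, gamma * `|y - z| <= e.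
    near=> y; have : `|y - z| <= e / (gamma + 1).
      by rewrite distrC; near: y; apply: cvgr_dist_le; rewrite ?divr_gt0.
    rewrite ler_pdivlMr //; have : 0 <= `|y - z| by []. nra.
  have zf := gradient_near fz e2.
  change (\forall y \near z, y != z -> V y); near=> y => yz.
  by split; [exact/eqP | split; near: y].
apply: le_ereal_inf_tmp => _ [y [yz [gy fy]] <-].
have n0 : 0 < `|y - z| by rewrite normr_gt0 subr_eq0; exact/eqP.
rewrite /F (objective_fineE domz).
have [domy|] := pselect (dom phi y); last first.
  rewrite /dom /objective /=; have := phi_NNy y.
  case: (phi y) => [r| |] //= _; rewrite ?ltry // => _.
  by rewrite addey // !addye // gt0_mulye ?leey // lte_fin invr_gt0.
rewrite (objective_fineE domy) -!EFinB -EFinM lee_fin ler_pdivlMr //.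
have := pg_minimizer_fine zmin domz domy.
have -> : y - u = (y - z) + (z - u) by rewrite addrA subrK.
move: fy gy n0; rewrite /w; move: (y - z) (z - u) => d v fy gy n0.
rewrite (normD_sqr d v) (linearDr _ (df u)) /=.
have -> : '[df z - df u - gamma *: v, d] = '[df z, d] - '[df u, d] - gamma * '[d, v].
  by rewrite innerC linearBr linearZr /= linearBr !(innerC _ d).
move: fy; rewrite ler_norml => /andP[+ _].
have : gamma * `|d| ^+ 2 <= e * `|d| by rewrite expr2 mulrA ler_wpM2r.
nra.
Unshelve. all: by end_near. Qed.
End ProximalStep.

(** * Local upper bound of the accepted parameters *)

Section Stepsize.
Context {R : realType} {X : euclideanType R}.
Variables (f : X -> R) (df : X -> X) (phi : X -> \bar R) (xs : X).
Hypothesis phi_NNy : forall y, phi y != -oo%E.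
Hypothesis f_grad : forall y, is_gradient f y (df y).
Hypothesis df_cont : continuous df.

(** The affine minorant and the bound P on the objective at u turn minimality
    into gamma / 2 n^2 <= C1 + C2 n, with n the distance from u to z and C1,
    C2 independent of u and gamma. A large gamma makes n < r / 2, so z lies in
    the ball on which df is Lipschitz, and the descent lemma applies as soon
    as L <= (1 - delta) gamma / 2. *)
Lemma large_gamma_accepted (a : X) (b P delta L r : R) :
  (forall y, (('[a, y] + b)%:E <= phi y)%E) -> 0 < delta < 1 -> 0 < L -> 0 < r ->
  (forall y z, ball xs r y -> ball xs r z -> `|df y - df z| <= L * `|y - z|) ->
  exists rho Gamma : R, [/\ 0 < rho, rho <= r / 2 &
    forall u gamma z, ball xs rho u -> dom phi u ->
      f u + fine (phi u) <= P -> Gamma <= gamma ->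
      pg_minimizer f df phi u gamma z -> pg_accept f phi delta u gamma z].
Proof.
move=> affine /andP[delta0 delta1] L0 r0 dfL.
pose h := r / 2; have h0 : 0 < h by rewrite divr_gt0.
have fc : {for xs, continuous f}.
  by apply: differentiable_continuous; have [] := f_grad xs.
have dfc : df y @[y --> xs] --> df xs by exact: df_cont.
have [rho0 /= rho00 near_xs] : exists2 rho0 : R, 0 < rho0 & forall u,
    ball xs rho0 u -> `|f xs - f u| < 1 /\ `|df xs - df u| < 1.
  have : \forall u \near xs, `|f xs - f u| < 1 /\ `|df xs - df u| < 1.
    near=> u; split; near: u.
    - exact: (cvgr_dist_lt _ _ fc _ ltr01).
    - exact: (cvgr_dist_lt _ _ dfc _ ltr01).
  by move=> /nbhs_ballP[e e0 eP]; exists e.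
pose C1 := `|P| + `|b| + `|f xs| + 1 + `|a| * (`|xs| + h).
pose C2 := `|a| + `|df xs| + 1.
pose Gamma := Num.max (2 / h * (C1 / h + C2) + 1) (2 * L / (1 - delta)).
have C10 : 0 < C1.
  by rewrite /C1 ltr_wpDr ?ltr_wpDl ?mulr_ge0 ?addr_ge0 // ltW.
have C20 : 0 < C2 by rewrite /C2 ltr_wpDl ?addr_ge0.
exists (Num.min rho0 h), Gamma; split; first by rewrite lt_min rho00.
  by rewrite ge_min lexx orbT.
move=> u gamma z u_near domu uP; rewrite /Gamma ge_max => /andP[gammaC gammaL] zmin.
have [/near_xs[fu dfu] uh] : ball xs rho0 u /\ ball xs h u.
  by split; apply: le_ball u_near; rewrite ge_min lexx ?orbT.
have domz := pg_minimizer_dom phi_NNy domu zmin.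
apply/pg_accept_fine => //.
have := pg_minimizer_fine phi_NNy zmin domz domu.
rewrite subrr linear0r normr0 expr0n /= mulr0 !add0r => model.
have affz : '[a, z] + b <= fine (phi z).
  by rewrite -lee_fin (dom_fineK phi_NNy domz).
have gamma0 : 0 < gamma.
  apply: lt_le_trans gammaL; rewrite divr_gt0 ?mulr_gt0 //; lra.
have zu_small : `|z - u| < h.
  (* If n >= h, the quadratic estimate divided by n bounds gamma. *)
  rewrite ltNge; apply/negP => hn.
  have n0 : 0 < `|z - u| by exact: lt_le_trans hn.
  have bound : gamma / 2 * `|z - u| ^+ 2 <= C1 + C2 * `|z - u|.
    have azu : '[a, z] = '[a, u] + '[a, z - u] by rewrite -linearDr addrC subrK.
    have au_le : - '[a, u] <= `|a| * (`|xs| + h).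
      rewrite -linearNr; apply: le_trans (inner_le_norm _ _) _.
      rewrite ler_wpM2l // normrN; move: uh; rewrite -ball_normE /= => uh.
      have := ler_distD xs u 0; rewrite !subr0 (distrC u xs); lra.
    have azu_le : - '[a, z - u] <= `|a| * `|z - u|.
      by rewrite -linearNr; apply: le_trans (inner_le_norm _ _) _; rewrite normrN.
    have dfd : - '[df u, z - u] <= (`|df xs| + 1) * `|z - u|.
      rewrite -linearNl; apply: le_trans (inner_le_norm _ _) _.
      rewrite normrN ler_wpM2r //.
      have := ler_distD (df xs) (df u) 0; rewrite !subr0 (distrC (df u)); lra.
    have := ler_norm P; have := ler_norm (- b); rewrite normrN => absb absP.
    have absf : - f u <= `|f xs| + 1.
      have := ler_norm (f xs - f u); have := ler_norm (- f xs); rewrite normrN; lra.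
    rewrite /C1 /C2; lra.
  have : gamma / 2 * `|z - u| <= C1 / h + C2.
    have C1n : C1 <= C1 / h * `|z - u|.
      by rewrite -mulrA ler_peMr ?(ltW C10) // mulrC ler_pdivlMr ?mul1r.
    rewrite -(ler_pM2r n0); move: bound C1n; move: `|z - u| (C1 / h) => n Ch; lra.
  have : gamma / 2 * h <= gamma / 2 * `|z - u|.
    by rewrite ler_wpM2l // divr_ge0 // ltW.
  move=> hz zC; move: gammaC; rewrite mulrAC -lerBrDr ler_pdivrMr //.
  lra.
have zr : ball xs r z.
  move: uh; rewrite -!ball_normE /= => uh.
  have := ler_distD u xs z; rewrite (distrC u z) /h; move: uh zu_small; rewrite /h; lra.
have ur : ball xs r u.
  by apply: le_ball uh; rewrite /h; lra.
have desc := descent_lemma f_grad L0 dfL ur zr.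
have n0 : 0 <= `|z - u| ^+ 2 by rewrite exprn_ge0.
have Lgamma : L <= (1 - delta) * (gamma / 2).
  by move: gammaL; rewrite ler_pdivrMr ?subr_gt0 //; lra.
have := ler_wpM2r n0 Lgamma; lra.
Unshelve. all: by end_near. Qed.
End Stepsize.

(** * Sequences generated by the method *)

Section ProximalGradientSequence.
Context {R : realType} {X : euclideanType R}.
Variables (f : X -> R) (df : X -> X) (phi : X -> \bar R).
Variables (tau gmin gmax delta : R).
Hypothesis phi_NNy : forall y, phi y != -oo%E.
Hypothesis f_grad : forall y, is_gradient f y (df y).
Hypothesis df_cont : continuous df.
Hypothesis phi_affine :
  exists (a : X) (b : R), forall y, (('[a, y] + b)%:E <= phi y)%E.
Hypothesis df_lip : locally_lipschitz df.
Hypothesis tau_gt1 : 1 < tau.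
Hypothesis gmin_gt0 : 0 < gmin.
Hypothesis delta01 : 0 < delta < 1.

(** Above gmax the accepted parameter is not the initial one, so the parameter
    tried just before, smaller by the factor tau, was rejected. *)
Lemma pg_step_accepted u z : dom phi u ->
  pg_step f df phi tau gmin gmax delta u z ->
  exists gamma, [/\ gmin <= gamma, pg_minimizer f df phi u gamma z,
    pg_accept f phi delta u gamma z &
    gmax < gamma -> exists z', pg_minimizer f df phi u (gamma / tau) z' /\
      ~ pg_accept f phi delta u (gamma / tau) z'].
Proof.
move=> domu [gamma0 [xt [ik [/andP[gamma0_ge gamma0_le] xt_min xt_rej xt_acc ->]]]].
have tau0 : 0 < tau by exact: lt_trans tau_gt1.
exists (tau ^+ ik * gamma0); split => //.
- apply: (le_trans gamma0_ge); rewrite ler_peMl ?exprn_ege1 ?ltW //.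
  exact: lt_le_trans gamma0_ge.
- by move=> y; apply: xt_min.
case: ik xt_min xt_rej {xt_acc} => [|i] xt_min xt_rej.
  by rewrite expr0 mul1r ltNge gamma0_le.
move=> _; exists (xt i).
have -> : tau ^+ i.+1 * gamma0 / tau = tau ^+ i * gamma0.
  by rewrite exprS; field; rewrite gt_eqF.
split; first by move=> y; apply: xt_min.
exact: xt_rej.
Qed.

Lemma pg_step_decrease u z : dom phi u ->
  pg_step f df phi tau gmin gmax delta u z ->
  dom phi z /\ delta * (gmin / 2) * `|z - u| ^+ 2 <=
    (f u + fine (phi u)) - (f z + fine (phi z)).
Proof.
move=> domu /(pg_step_accepted domu)[gamma [gamma_ge zmin + _]].
have domz := pg_minimizer_dom phi_NNy domu zmin.
move=> /(pg_accept_fine f phi_NNy delta gamma domu domz) acc; split => //.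
have /andP[delta0 _] := delta01.
have n0 : 0 <= `|z - u| ^+ 2 by rewrite exprn_ge0.
have : delta * (gmin / 2) <= delta * (gamma / 2) by rewrite ler_pM2l //; lra.
move=> /(ler_wpM2r n0); lra.
Qed.

(** A parameter above both gmax and tau Gamma would have been preceded by a
    rejected one above Gamma, contradicting large_gamma_accepted. *)
Lemma pg_step_local xs P : exists rho G L : R,
  [/\ 0 < rho, 0 < G, 0 < L,
    (forall u z, ball xs rho u -> ball xs rho z -> `|df u - df z| <= L * `|u - z|) &
    forall u z, ball xs rho u -> dom phi u -> f u + fine (phi u) <= P ->
      pg_step f df phi tau gmin gmax delta u z ->
      exists gamma, [/\ gmin <= gamma, gamma <= G & pg_minimizer f df phi u gamma z]].
Proof.
have [L [r [L0 r0 dfL]]] := locally_lipschitz_ball xs df_lip.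
have [a [b affine]] := phi_affine.
have [rho [Gamma [rho0 rhor accepted]]] :=
  large_gamma_accepted phi_NNy f_grad df_cont P affine delta01 L0 r0 dfL.
have tau0 : 0 < tau by exact: lt_trans tau_gt1.
exists rho, (Num.max (Num.max gmin gmax) (tau * Gamma)), L; split => //.
- by rewrite !lt_max gmin_gt0.
- by move=> u z u_near z_near; apply: dfL; [move: u_near|move: z_near]; apply: le_ball; lra.
move=> u z u_near domu uP /(pg_step_accepted domu)[gamma [gamma_ge zmin _ rej]].
exists gamma; split => //; rewrite !le_max.
have [//|/rej[z' [z'min z'rej]]] := leP gamma gmax; first by rewrite orbT.
have [le_tG|lt_tG] := leP gamma (tau * Gamma); first by rewrite orbT.
exfalso; apply: z'rej; apply: accepted => //.
by rewrite ler_pdivlMr // mulrC ltW.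
Qed.

Lemma regular_subdiff_limiting (theta : X -> \bar R) z w :
  regular_subdiff theta z w -> limiting_subdiff theta z w.
Proof.
move=> zw; split; first by case: zw.
by exists (fun=> z), (fun=> w); split=> //; exact: cvg_cst.
Qed.

Lemma pg_step_slope xs P : exists rho M : R, [/\ 0 < rho, 0 < M &
  forall u z, ball xs rho u -> ball xs rho z -> dom phi u ->
    f u + fine (phi u) <= P -> pg_step f df phi tau gmin gmax delta u z ->
    (dist 0%R (limiting_subdiff (objective f phi) z) <= (M * `|z - u|)%:E)%E].
Proof.
have [rho [G [L [rho0 G0 L0 dfL local]]]] := pg_step_local xs P.
exists rho, (L + G); split => //; first exact: addr_gt0.
move=> u z u_near z_near domu uP /(local _ _ u_near domu uP)[gamma].
move=> [gamma_ge gamma_le zmin].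
have domz := pg_minimizer_dom phi_NNy domu zmin.
have gamma0 : 0 <= gamma by apply: le_trans gamma_ge; exact: ltW.
have sub := pg_minimizer_subdiff phi_NNy gamma0 (f_grad z) zmin domz.
apply: ge_ereal_inf; eexists.
  exists (df z - df u - gamma *: (z - u)); last reflexivity.
  exact: regular_subdiff_limiting.
rewrite lee_fin subr0 (le_trans (ler_normB _ _)) // normrZ ger0_norm //.
have := dfL _ _ z_near u_near.
have : gamma * `|z - u| <= G * `|z - u| by rewrite ler_wpM2r.
lra.
Qed.

Variable x : nat -> X.
Hypothesis x_pg : pg_sequence f df phi tau gmin gmax delta x.
Hypothesis psi_bounded :
  exists m : R, forall y, dom phi y -> (m%:E <= objective f phi y)%E.

Lemma pg_dom k : dom phi (x k).
Proof.
have [dom0 step] := x_pg; elim: k => // k domk.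
exact: (pg_step_decrease domk (step k)).1.
Qed.

Let p k := f (x k) + fine (phi (x k)).

Lemma pg_decrease k :
  delta * (gmin / 2) * `|x k.+1 - x k| ^+ 2 <= p k - p k.+1.
Proof. exact: (pg_step_decrease (pg_dom k) (x_pg.2 k)).2. Qed.

Lemma pg_alpha_gt0 : 0 < delta * (gmin / 2).
Proof. by have /andP[delta0 _] := delta01; rewrite mulr_gt0 // divr_gt0. Qed.

Lemma pg_nonincreasing : nonincreasing_seq p.
Proof.
apply/nonincreasing_seqP => k; rewrite -subr_ge0.
by apply: le_trans (pg_decrease k); rewrite mulr_ge0 ?exprn_ge0 // ltW // pg_alpha_gt0.
Qed.

(** The values decrease to some limit l. If l were below the value at xs,
    lower semicontinuity would keep the values along the subsequence away from
    l. In the other direction, the subproblem at x_(sigma n) compares its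
    solution with xs; both points and the centre tend to xs and the parameters
    stay bounded, so the terms of this comparison other than the values of phi
    vanish in the limit. *)
Lemma pg_objective_cvg (sigma : nat -> nat) (xs : X) :
  {homo sigma : m n / (m < n)%N} -> x (sigma n) @[n --> \oo] --> xs ->
  lower_semicontinuous (objective f phi) -> dom phi xs ->
  p @ \oo --> f xs + fine (phi xs).
Proof.
move=> sigma_incr x_sub lsc domxs.
have pcvg : cvgn p.
  apply: nonincreasing_is_cvgn; first exact: pg_nonincreasing.
  have [m mP] := psi_bounded; exists m => _ [k _ <-].
  by have := mP _ (pg_dom k); rewrite objective_fineE // ?lee_fin //; exact: pg_dom.
have [l pl] : exists l : R, p @ \oo --> l by exists (limn p).
have l_le k : l <= p k.
  rewrite -(cvg_lim _ pl) //; apply: nonincreasing_cvgn_ge => //.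
  exact: pg_nonincreasing.
have sigma_ge n : (n <= sigma n)%N.
  by elim: n => // n IH; apply: leq_ltn_trans IH (sigma_incr _ _ _).
have sigma_oo : sigma n @[n --> \oo] --> \oo.
  move=> A [N _ NA]; exists N => // n /= Nn; apply: NA => /=.
  exact: leq_trans Nn (sigma_ge n).
suff -> : f xs + fine (phi xs) = l by [].
apply/le_anti/andP; split.
  rewrite leNgt; apply/negP => l_lt.
  have [|V xsV psiV] := lsc xs ((l + (f xs + fine (phi xs))) / 2).
    by rewrite objective_fineE // lte_fin; lra.
  have psub : p (sigma n) @[n --> \oo] --> l by exact: cvg_comp sigma_oo pl.
  have psmall : \forall n \near \oo, p (sigma n) < (l + (f xs + fine (phi xs))) / 2.
    by apply: (cvgr_lt _ psub _); lra.
  have xV : \forall n \near \oo, V (x (sigma n)) by exact: x_sub.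
  have [n [Vn pn]] := filter_ex (filterI xV psmall).
  have := psiV _ Vn; rewrite objective_fineE ?lte_fin; [|exact: phi_NNy|exact: pg_dom].
  by move=> /(lt_trans pn); rewrite ltxx.
have [rho [G [L [rho0 G0 L0 dfL local]]]] := pg_step_local xs (p 0%N).
have fc y : {for y, continuous f}.
  by apply: differentiable_continuous; have [] := f_grad y.
have steps := step_cvg0 pg_alpha_gt0 pg_decrease pl.
have steps_sub : `|x (sigma n).+1 - x (sigma n)| @[n --> \oo] --> 0.
  exact: cvg_comp sigma_oo steps.
have x_sub1 : x (sigma n).+1 @[n --> \oo] --> xs.
  have -> : (fun n => x (sigma n).+1) =
      (fun n => (x (sigma n).+1 - x (sigma n)) + x (sigma n)).
    by apply/funext => n; rewrite subrK.
  rewrite -[xs]add0r; apply: cvgD => //.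
  exact/norm_cvg0P.
have x_close : `|xs - x (sigma n)| @[n --> \oo] --> 0.
  by rewrite -(normr0 X) -(subrr xs); apply: cvg_norm; apply: cvgB => //; exact: cvg_cst.
pose F n := f (x (sigma n).+1) + fine (phi xs) +
  `|df (x (sigma n))| * (`|xs - x (sigma n)| + `|x (sigma n).+1 - x (sigma n)|) +
  G / 2 * (`|xs - x (sigma n)| * `|xs - x (sigma n)|).
have F_cvg : F @ \oo --> f xs + fine (phi xs) +
    `|df xs| * (0 + 0) + G / 2 * (0 * 0).
  apply: cvgD; first apply: cvgD; first apply: cvgD.
  - exact: continuous_cvg (fc xs) x_sub1.
  - exact: cvg_cst.
  - apply: cvgM; last exact: cvgD.
    by apply: cvg_norm; apply: continuous_cvg x_sub; exact: df_cont.
  - by apply: cvgMl_tmp; exact: cvgM.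
have -> : f xs + fine (phi xs) = lim (F @ \oo).
  rewrite (cvg_lim _ F_cvg) //; ring.
apply: limr_ge; first by apply/cvg_ex; eexists; exact: F_cvg.
have close : \forall n \near \oo, ball xs rho (x (sigma n)) by exact: cvg_ball.
near=> n.
have domn := pg_dom (sigma n).
have un : ball xs rho (x (sigma n)) by near: n.
have [gamma [gamma_ge gamma_le zmin]] :=
  local _ _ un domn (pg_nonincreasing (leq0n _)) (x_pg.2 (sigma n)).
have model := pg_minimizer_fine phi_NNy zmin (pg_dom _) domxs.
apply: le_trans (l_le (sigma n).+1) _; rewrite /p /F.
move: (x (sigma n)) (x (sigma n).+1) => u z in zmin model *.
have := inner_le_norm (df u) (xs - u).
have := inner_le_norm (- df u) (z - u).
rewrite normrN linearNl /=.
have : gamma / 2 * `|xs - u| ^+ 2 <= G / 2 * `|xs - u| ^+ 2.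
  by rewrite ler_wpM2r ?exprn_ge0 //; lra.
have : 0 <= gamma / 2 * `|z - u| ^+ 2.
  by rewrite mulr_ge0 ?exprn_ge0 // divr_ge0 // (le_trans (ltW gmin_gt0)).
lra.
Unshelve. all: by end_near. Qed.

End ProximalGradientSequence.

(** * Convergence and rates *)

Theorem theorem4p6 (R : realType) (X : euclideanType R)
    (f : X -> R) (df : X -> X) (phi : X -> \bar R)
    (tau gmin gmax delta : R) (x : nat -> X) (sigma : nat -> nat) (xs : X)
    (psi := objective f phi)
    (f_grad : forall y, is_gradient f y (df y))
    (f_C1 : continuous df)
    (phi_NNy : forall y, phi y != -oo%E)
    (phi_lsc : lower_semicontinuous phi)
    (phi_proper : dom phi !=set0)
    (psi_bounded : exists m : R, forall y, dom phi y -> (m%:E <= psi y)%E)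
    (phi_affine : exists (a : X) (b : R), forall y, (('[a, y] + b)%:E <= phi y)%E)
    (df_lip : locally_lipschitz df)
    (tau_gt1 : 1 < tau)
    (gmin_gt0 : 0 < gmin) (gmin_gmax : gmin <= gmax)
    (delta01 : 0 < delta < 1)
    (x_pg : pg_sequence f df phi tau gmin gmax delta x)
    (sigma_incr : {homo sigma : m n / (m < n)%N})
    (x_sub : x (sigma n) @[n --> \oo] --> xs)
    (psi_KL : KL_property psi xs) :
  x @ \oo --> xs /\
  forall (eta c : R) (chi : R -> R),
    KL_with psi xs eta chi ->
    0 < c ->
    (forall t, 0 <= t <= eta -> chi t = c * t `^ 2^-1) ->
    q_linear (fun k => fine (psi (x k))) (fine (psi xs)) /\
    r_linear x xs.
Proof.
have [psi_lsc domxs] : lower_semicontinuous psi /\ dom phi xs.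
  have [eta [chi [lsc [w [domw _]] _ _ _]]] := psi_KL; split => //.
  exact/(dom_objective f phi_NNy).
have domx := pg_dom phi_NNy tau_gt1 gmin_gt0 delta01 x_pg.
pose p k := fine (psi (x k)); pose ps := fine (psi xs).
have psiE y : dom phi y -> psi y = (fine (psi y))%:E.
  by move=> domy; rewrite /psi objective_fineE.
have pE k : p k = f (x k) + fine (phi (x k)) by rewrite /p /psi objective_fineE.
have psE : ps = f xs + fine (phi xs) by rewrite /ps /psi objective_fineE.
have decrease k : delta * (gmin / 2) * `|x k.+1 - x k| ^+ 2 <= p k - p k.+1.
  by rewrite !pE; exact: (pg_decrease phi_NNy tau_gt1 gmin_gt0 delta01 x_pg).
have alpha0 := pg_alpha_gt0 gmin_gt0 delta01.
have p_cvg : p @ \oo --> ps.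
  rewrite psE (_ : p = fun k => f (x k) + fine (phi (x k))); last exact/funext.
  exact: (pg_objective_cvg phi_NNy f_grad f_C1 phi_affine df_lip tau_gt1
    gmin_gt0 delta01 x_pg psi_bounded sigma_incr x_sub).
have [rho [M [rho0 M0 slope]]] := pg_step_slope gmax phi_NNy f_grad f_C1
  phi_affine df_lip tau_gt1 gmin_gt0 delta01 xs (p 0%N).
have p_le0 k : f (x k) + fine (phi (x k)) <= p 0%N.
  rewrite pE; exact: (pg_nonincreasing phi_NNy tau_gt1 gmin_gt0 delta01 x_pg (leq0n k)).
have slope_x k : ball xs rho (x k) -> ball xs rho (x k.+1) ->
    (dist 0%R (limiting_subdiff psi (x k.+1)) <= (M * `|x k.+1 - x k|)%:E)%E.
  by move=> xk xk1; apply: slope => //; exact: x_pg.2.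
have psixE k : psi (x k) = (p k)%:E by exact: psiE.
have psixsE : psi xs = ps%:E by exact: psiE.
have x_cvg : x @ \oo --> xs.
  exact: (KL_descent_cvg psixE psixsE alpha0 M0 rho0 decrease slope_x p_cvg
    sigma_incr x_sub psi_KL).
split => // eta c chi KL c0 chiE.
have q_lin : q_linear p ps.
  exact: (KL_sqrt_q_linear psixE psixsE alpha0 M0 rho0 decrease slope_x p_cvg
    x_cvg KL c0 chiE).
split; first exact: q_lin.
exact: (q_linear_r_linear alpha0 decrease p_cvg x_cvg q_lin).
Qed.
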